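(* Consider the quantized observation model described in the context, with family $\mathcal{R}=\{R_\theta:\theta\in\Theta\}$, true parameter $\theta_0\in\Theta$, noise level $p$, and observations $Y_k=\pi(R_{\theta_0}^kU)\oplus\varepsilon_k$, $k\ge0$. Suppose that either (1) $p=0$, or (2) $0<p<1/2$ and $h(\mathcal{R})=0$. Then for every sequence of measurable estimators $\theta_n:\{0,1\}^n\to\Theta$, $n\ge1$, satisfying, with $\hat\theta_n=\theta_n(Y_0,\dots,Y_{n-1})$, $$\lim_n\inf_{u\in\mathcal{U}}\frac1n\sum_{k=0}^{n-1}\mathbb{I}\big(\pi(R_{\hat\theta_n}^ku)\ne Y_k\big)=\lim_n\inf_{\theta\in\Theta}\inf_{u\in\mathcal{U}}\frac1n\sum_{k=0}^{n-1}\mathbb{I}\big(\pi(R_\theta^ku)\ne Y_k\big)\quad\text{with probability one},\qquad( * )$$ $\hat\theta_n$ converges almost surely to $\Theta_1=\{\theta\in\Theta:\nu_0(\mathcal{X}_\theta)=1\}$. Conversely, for every $\theta^*\in\Theta_1$ there exists a sequence of measurable estimators $\{\theta_n\}$ satisfying $( * )$ such that $\hat\theta_n$ converges almost surely to $\theta^*$.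
   Context: Model: $\mathcal{U}$ is a Polish space, $\Theta$ is a compact metric space, and $\mathcal{R}=\{R_\theta:\theta\in\Theta\}$ is a family of Borel measurable maps $R_\theta:\mathcal{U}\to\mathcal{U}$ such that $(\theta,u)\mapsto R_\theta(u)$ is Borel measurable from $\Theta\times\mathcal{U}$ to $\mathcal{U}$. $\{A_0,A_1\}$ is a fixed measurable partition of $\mathcal{U}$ and $\pi:\mathcal{U}\to\{0,1\}$ is given by $\pi(u)=j$ if $u\in A_j$. $\theta_0\in\Theta$; $U$ is a $\mathcal{U}$-valued random variable whose distribution is invariant and ergodic under $R_{\theta_0}$; $\{\varepsilon_k\}_{k\ge0}$ are independent Bernoulli$(p)$ random variables, independent of $U$; $\oplus$ is addition modulo 2. Notation: $\mathrm{lab}(\theta,u)=(\pi(u),\pi(R_\theta u),\pi(R_\theta^2u),\dots)\in\{0,1\}^{\mathbb{N}}$, where $\{0,1\}^{\mathbb{N}}$ has the product topology. $\mathcal{X}$ is the closure of $\{(\theta,\mathrm{lab}(\theta,u)):\theta\in\Theta,u\in\mathcal{U}\}$ in $\Theta\times\{0,1\}^{\mathbb{N}}$, and $\mathcal{X}_\theta=\{\mathbf{a}\in\{0,1\}^{\mathbb{N}}:(\theta,\mathbf{a})\in\mathcal{X}\}$. $\nu_0$ is the distribution on $\{0,1\}^{\mathbb{N}}$ of the noise-free label process $(\pi(R_{\theta_0}^kU))_{k\ge0}$. $\mathcal{L}$ is the closure in $\{0,1\}^{\mathbb{N}}$ of $\{\mathrm{lab}(\theta,u):\theta\in\Theta,u\in\mathcal{U}\}$,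 and $$h(\mathcal{R})=\lim_n\frac1n\log\#\{a_0^{n-1}\in\{0,1\}^n:\mathbf{a}\in\mathcal{L}\},$$ where $a_0^{n-1}=(a_0,\dots,a_{n-1})$. $\mathbb{I}$ denotes the indicator. A sequence in $\Theta$ converges to a set if its distance to the set tends to $0$. *)

(* Defs.v *)
From HB Require Import structures.
From mathcomp Require Import all_boot all_order all_algebra finmap.
From mathcomp Require Import all_classical all_reals all_analysis.

Set Implicit Arguments.
Unset Strict Implicit.
Unset Printing Implicit Defensive.

Import Order.TTheory GRing.Theory Num.Theory.
Import numFieldNormedType.Exports.

Local Open Scope classical_set_scope.
Local Open Scope ring_scope.

Definition compatible_metric (R : realType) (T : topologicalType)
    (dist : T -> T -> R) : Prop :=
  [/\ forall x y, dist x y = 0 <-> x = y,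
      forall x y, dist x y = dist y x,
      forall x y z, dist x z <= dist x y + dist y z &
      forall x (A : set T),
        nbhs x A <-> exists2 e, 0 < e & [set y | dist x y < e] `<=` A].

Definition complete_metric (R : realType) (T : topologicalType)
    (dist : T -> T -> R) : Prop :=
  forall x : nat -> T,
    (forall e, 0 < e -> exists N, forall m n, (N <= m)%N -> (N <= n)%N ->
       dist (x m) (x n) < e) ->
    exists l : T, x @ \oo --> l.

Definition polish_space (R : realType) (T : topologicalType) : Prop :=
  (exists2 D : set T, countable D & dense D) /\
  (exists2 dist : T -> T -> R, compatible_metric dist & complete_metric dist).

(* In the library a measurable space is a pointed type. The spaces Theta and U
   below are nonempty, so requiring a point in them costs nothing. *)
#[short(type="pmetricType")]
HB.structure Definition PointedMetric (R : numDomainType) :=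
  {T of Metric R T & Pointed T}.

(* Pairs are pointed and topological in the library, but the join is missing. *)
HB.instance Definition _ (S T : ptopologicalType) :=
  Pointed.on (S * T)%type.

Notation borel T := (g_sigma_algebraType (@open T)).

Definition borel_measurable (S T : ptopologicalType) (f : S -> T) : Prop :=
  measurable_fun [set: borel S] (f : borel S -> borel T).

Definition invariant_law d (T : measurableType d) (R : realType)
    (mu : set T -> \bar R) (f : T -> T) : Prop :=
  forall A, measurable A -> mu (f @^-1` A) = mu A.

Definition ergodic_law d (T : measurableType d) (R : realType)
    (mu : set T -> \bar R) (f : T -> T) : Prop :=
  forall A, measurable A -> f @^-1` A = A -> mu A = 0%E \/ mu A = 1%E.

Definition independent_family d (Omega : measurableType d) (R : realType)
    (P : probability Omega R) (I : choiceType) d' (S : measurableType d')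
    (X : I -> Omega -> S) : Prop :=
  forall (J : {fset I}) (B : I -> set S), (forall i, measurable (B i)) ->
    P (\bigcap_(i in [set` J]) (X i @^-1` B i)) =
    (\prod_(i <- J) P (X i @^-1` B i))%E.

Definition independent d (Omega : measurableType d) (R : realType)
    (P : probability Omega R) d1 (S1 : measurableType d1)
    d2 (S2 : measurableType d2) (X : Omega -> S1) (Y : Omega -> S2) : Prop :=
  forall B1 B2, measurable B1 -> measurable B2 ->
    P ((X @^-1` B1) `&` (Y @^-1` B2)) = (P (X @^-1` B1) * P (Y @^-1` B2))%E.

(* The labels 0 and 1 are the booleans false and true; addb is then the sum
   modulo 2, and cantor_space is {0,1}^N with its product topology. *)
Definition measurable_partition (U : ptopologicalType) (A : bool -> set U)
    : Prop :=
  [/\ forall j, measurable (A j : set (borel U)),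
      trivIset setT A & \bigcup_j A j = setT].

Section Model.

Context (R : realType) (Theta : pmetricType R) (U : ptopologicalType)
  (F : Theta -> U -> U) (pi : U -> bool).

Definition lab (th : Theta) (u : U) : cantor_space :=
  fun k => pi (iter k (F th) u).

(* label_graph is the set X of the paper, and label_slice th its section X_th. *)
Definition label_graph : set (Theta * cantor_space) :=
  closure [set x | exists th u, x = (th, lab th u)].

Definition label_slice (th : Theta) : set cantor_space :=
  [set a | label_graph (th, a)].

(* The set L, whose words determine h(R) below. *)
Definition label_closure : set cantor_space :=
  closure [set a | exists th u, a = lab th u].

Definition label_words (n : nat) : {set n.-tuple bool} :=
  [set w | `[< exists2 a, label_closure a & w = [tuple a i | i < n] >]]%SET.

Definition entropy : R :=
  limn (fun n => n%:R^-1 * ln (#|label_words n|%:R : R)).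

Definition mismatch (n : nat) (y : nat -> bool) (th : Theta) (u : U) : R :=
  n%:R^-1 * \sum_(k < n) (pi (iter k (F th) u) != y k)%:R.

Definition min_mismatch (n : nat) (y : nat -> bool) (th : Theta) : R :=
  inf (range (mismatch n y th)).

Definition global_min_mismatch (n : nat) (y : nat -> bool) : R :=
  inf (range (min_mismatch n y)).

Definition estimate (theta : forall n, n.-tuple bool -> Theta)
    (n : nat) (y : nat -> bool) : Theta :=
  theta n [tuple y i | i < n].

(* theta n is an estimator based on n observations; its value at n = 0 is
   irrelevant.  Equality of the two limits includes the existence of both of them. *)
Definition min_error (theta : forall n, n.-tuple bool -> Theta)
    (y : nat -> bool) : Prop :=
  exists l : R,
    (fun n => min_mismatch n y (estimate theta n y)) @ \oo --> l /\
    (fun n => global_min_mismatch n y) @ \oo --> l.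

Definition measurable_estimators (theta : forall n, n.-tuple bool -> Theta)
    : Prop :=
  forall n, measurable_fun [set: n.-tuple bool]
    (theta n : n.-tuple bool -> borel Theta).

Context d (Omega : measurableType d) (P : probability Omega R)
  (th0 : Theta) (X : Omega -> U) (eps : nat -> Omega -> bool).

Definition obs (w : Omega) (k : nat) : bool := lab th0 (X w) k (+) eps k w.

Definition label_law : set (borel cantor_space) -> \bar R :=
  pushforward P (fun w => lab th0 (X w) : borel cantor_space).

Definition Theta1 : set Theta := [set th | label_law (label_slice th) = 1%E].

End Model.

Arguments entropy {R Theta U} F pi.
Arguments min_error {R Theta U} F pi theta y.
Arguments obs {R Theta U} F pi {d Omega} th0 X eps w k.
Arguments Theta1 {R Theta U} F pi {d Omega} P th0 X.

(* Main.v *)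
Require Import Defs.
From mathcomp Require Import all_boot all_order all_algebra finmap.
From mathcomp Require Import all_classical all_reals all_analysis.
From mathcomp Require Import measurable_realfun ring lra zify.

Import Order.TTheory GRing.Theory Num.Theory.
Import numFieldNormedType.Exports.

Local Open Scope classical_set_scope.
Local Open Scope ring_scope.

(** Write [a] for the noise-free labels [lab F pi th0 (X w)] and [Y] for their
noisy version, [Y k = a k (+) eps k w].

Removing the noise. Fix a word [b] of length [n]. Given [a], the number of
places where [b] and [Y] differ has mean [n p + (1 - 2 p) D], where [D] counts
the places where [b] and [a] differ, and by a Chernoff bound it falls short of
this mean by [t n] only with a probability exponentially small in [n]
([chernoff], [chernoff_event]). Zero entropy, together with Fekete's lemma
which makes the entropy a genuine limit, leaves only [exp (o(n))] label words
[b], so a union bound and the Borel-Cantelli lemma give almost surely, for every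
[t] and all large [n], the bound
[mismatch Y >= p + (1 - 2 p) mismatch a - t] simultaneously for all parameters
and all initial points ([noise_control]). When [p = 0] this is trivial since
[Y = a]. As the true parameter achieves about [p], the global minimum tends to
[p]; an estimator that also achieves [p] must therefore have a minimal mismatch
with [a] itself tending to [0] ([min_mismatch_label_cvg]).

Identifying the limits. By ergodicity every word [s] of positive probability
occurs in almost every [a] with positive lower frequency ([visits_lower]).
Suppose that labels produced at parameters [th n] agree with [a] up to a
vanishing proportion of errors. An error spoils at most [size s] occurrences of
[s], so [s] survives in the labels of [th n], and shifting the initial point
moves it to the start. Hence, at an accumulation point [t] of [th], every word
of positive probability starts a label sequence of some parameter arbitrarily
close to [t]. Almost every [a] has only prefixes of positive probability, so
almost every [a] lies in the slice at [t], that is, [t] is in [Theta1]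
([label_consistency]). Compactness turns this into convergence to [Theta1].

The converse. If [t] is in [Theta1], then almost surely the first [n] labels
of [a] are exactly produced by a parameter within [1 / (n + 1)] of [t]. An
estimator that nearly minimises the mismatch over this ball thus has an error
of at most the average noise plus [1 / (n + 1)], which tends to [p]. *)

(** * Lower visit frequencies in ergodic systems *)

Definition visits {T : Type} (f : T -> T) (C : set T) (n : nat) (u : T) : nat :=
  \sum_(k < n) (iter k f u \in C).

Lemma visits_add {T : Type} (f : T -> T) (C : set T) m n u :
  visits f C (m + n) u = (visits f C m u + visits f C n (iter m f u))%N.
Proof.
rewrite /visits big_split_ord /=; congr addn.
by apply: eq_bigr => i _; rewrite -iterD addnC.
Qed.

Lemma visits_le {T : Type} (f : T -> T) (C : set T) n u :
  (visits f C n u <= n)%N.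
Proof.
rewrite /visits -[leqRHS]card_ord -sum1_card; apply: leq_sum => i _.
exact: leq_b1.
Qed.

(** Covering argument of Katznelson and Weiss: an orbit segment is cut greedily
into pieces of length at most [N] on which the visits are rare, single steps
from bad points, and a last piece of length at most [N], paid for by [N%:R]. *)
Lemma visits_covering {R : realType} {T : Type} (f : T -> T) (C Bad : set T)
    (c : R) (N : nat) : 0 <= c ->
  (forall u, ~ Bad u ->
     exists2 n, (n <= N)%N & (visits f C n u)%:R < c * n%:R) ->
  forall L u, (visits f C L u)%:R <= c * L%:R + N%:R + (visits f Bad L u)%:R.
Proof.
move=> c0 H L; have [k] := ubnP L; elim: k L => // k IH L Lk u.
have [LN|NL] := leqP L N.
  rewrite -[leLHS]add0r -[leLHS]addr0 !lerD ?ler0n ?mulr_ge0//.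
  by rewrite ler_nat (leq_trans (visits_le _ _ _ _)).
have [uB|/H[n nN cn]] := pselect (Bad u).
  case: L => // L in Lk NL *.
  rewrite -[L.+1]add1n !visits_add {1 3}/visits !big_ord1/= (mem_set uB).
  have /= := IH L Lk (f u); rewrite !natrD => IHu.
  have : ((u \in C)%:R : R) <= 1 by rewrite lern1 leq_b1.
  by lra.
have n0 : (0 < n)%N.
  by case: n cn {nN} => //; rewrite mulr0 /visits big_ord0 ltxx.
have -> : L = (n + (L - n))%N by lia.
rewrite !visits_add !natrD.
have := IH (L - n)%N ltac:(lia) (iter n f u).
by have := ler0n R (visits f Bad n u); lra.
Qed.

Section ergodic.
Context {R : realType} {d : measure_display} {T : measurableType d}.
Variables (mu : probability T R) (f : T -> T).
Hypothesis mf : measurable_fun setT f.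
Hypothesis inv : invariant_law mu f.

Lemma measurable_iter k : measurable_fun setT (iter k f).
Proof.
by elim: k => [|k IH]; [exact: measurable_id|exact: measurableT_comp].
Qed.

Lemma measurable_preimage_iter k (C : set T) :
  measurable C -> measurable (iter k f @^-1` C).
Proof. by move=> mC; rewrite -[X in measurable X]setTI; exact: measurable_iter. Qed.

Lemma mu_preimage_iter k (C : set T) :
  measurable C -> mu (iter k f @^-1` C) = mu C.
Proof.
move=> mC; elim: k => [//|k IH].
rewrite -[RHS]IH -(inv _ (measurable_preimage_iter k _ mC)).
by congr (mu _); apply/seteqP; split=> x /=; rewrite -iterSr.
Qed.

Lemma visitsE (C : set T) n u :
  ((visits f C n u)%:R : R) = \sum_(k < n) \1_(iter k f @^-1` C) u.
Proof.
rewrite /visits natr_sum; apply: eq_bigr => k _.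
by rewrite indicE; congr (_%:R); congr nat_of_bool; apply/idP/idP; rewrite !inE.
Qed.

Lemma measurable_visits (C : set T) n : measurable C ->
  measurable_fun setT (fun u => (visits f C n u)%:R : R).
Proof.
move=> mC; rewrite (_ : (fun u => _) =
    (fun u => \sum_(k < n) \1_(iter k f @^-1` C) u)); last first.
  by apply/funext => u; exact: visitsE.
apply: measurable_sum => k; apply/measurable_indic.
exact: measurable_preimage_iter.
Qed.

Lemma integral_visits (C : set T) n : measurable C ->
  (\int[mu]_u ((visits f C n u)%:R : R)%:E = (n%:R)%:E * mu C)%E.
Proof.
move=> mC.
under eq_integral do rewrite visitsE -sumEFin.
rewrite ge0_integral_sum//; first last.
- by move=> k; apply/measurable_EFinP/measurable_indic; exact: measurable_preimage_iter.
rewrite (eq_bigr (fun=> mu C)) => [|k _]; last first.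
  rewrite integral_indic//; last exact: measurable_preimage_iter.
  by rewrite setIT; exact: mu_preimage_iter.
by rewrite sumr_const card_ord mule_natl.
Qed.

(** Integrating the covering bound over orbit segments of length [L] gives
[mu C <= c + mu (Bad N)] as [L] grows, where [Bad N] is the set of points that
have to wait longer than [N]; the sets [Bad N] decrease to a null set. *)
Lemma mean_le_of_visits (C : set T) (c : R) : measurable C -> 0 <= c ->
  (\forall u \ae mu, exists n, (visits f C n u)%:R < c * n%:R) ->
  (mu C <= c%:E)%E.
Proof.
move=> mC c0 hC.
pose Bad N := \bigcap_(n < N.+1) [set u | c * n%:R <= (visits f C n u)%:R].
have mS n : measurable [set u : T | c * n%:R <= (visits f C n u)%:R].
  rewrite -[X in measurable X]setTI.
  by apply: measurable_fun_le => //; exact: measurable_visits.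
have mBad N : measurable (Bad N).
  by apply: bigcap_measurable => [|n _]; [exists 0|exact: mS].
have mBI : measurable (\bigcap_N Bad N) by exact: bigcapT_measurable.
have Bad0 : mu (\bigcap_N Bad N) = 0%E.
  apply/negligibleP => //; apply: negligibleS hC => u /= hu [n].
  by rewrite ltNge => /negP; apply; apply: (hu n I n) => /=.
have cvgBad : (mu \o Bad) x @[x --> \oo] --> 0%E.
  rewrite -Bad0; apply: nonincreasing_cvg_mu => //.
    by rewrite (le_lt_trans (probability_le1 _ _))// ltry.
  move=> m n mn; apply/subsetPset => u hu k /= km; apply: hu => /=.
  exact: leq_trans km _.
have key N : (mu C <= (c%:E + mu (Bad N)))%E.
  have fC : mu C \is a fin_num by exact: fin_num_measure.
  have fB : mu (Bad N) \is a fin_num by exact: fin_num_measure.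
  have H L : fine (mu C) * L%:R <= c * L%:R + N%:R + fine (mu (Bad N)) * L%:R.
    have hB v : ~ Bad N v ->
        exists2 n, (n <= N)%N & (visits f C n v)%:R < c * n%:R.
      move=> Bv; apply: contrapT => hn; apply: Bv => n /= nN.
      by rewrite leNgt; apply/negP => h; apply: hn; exists n.
    have : (\int[mu]_u ((visits f C L u)%:R : R)%:E <=
       \int[mu]_u (((c * L%:R + N%:R) : R)%:E + ((visits f (Bad N) L u)%:R)%:E))%E.
      apply: ge0_le_integral => //.
      - by apply/measurable_EFinP; exact: measurable_visits.
      - apply: emeasurable_funD => //.
        by apply/measurable_EFinP; exact: measurable_visits.
      move=> u _; rewrite -EFinD lee_fin; exact: visits_covering hB L u.
    rewrite ge0_integralD//; first last.
    - by apply/measurable_EFinP; exact: measurable_visits.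
    - by move=> u _; rewrite lee_fin addr_ge0// mulr_ge0.
    rewrite !integral_visits// integral_cst//.
    rewrite [X in (_ <= _ * X + _)%E](probability_setT mu) mule1.
    rewrite -(fineK fC) -(fineK fB) -!EFinM -EFinD lee_fin.
    by rewrite (mulrC L%:R) (mulrC L%:R).
  rewrite -(fineK fC) -(fineK fB) -EFinD lee_fin leNgt; apply/negP => hlt.
  set e := fine (mu C) - (c + fine (mu (Bad N))).
  have e0 : 0 < e by rewrite subr_gt0.
  (* Long enough for the boundary term N to be negligible against L * e. *)
  pose L := (Num.truncn (N%:R / e)).+1.
  have : N%:R / e < L%:R by exact: truncnS_gt.
  rewrite ltr_pdivrMr// => hL; have := H L; rewrite /e in hL; lra.
have : (fun N => c%:E + mu (Bad N))%E @ \oo --> (c%:E + 0)%E.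
  by apply: cvgeD => //; exact: cvg_cst.
rewrite adde0 => hcv.
rewrite -(cvg_lim _ hcv)//; apply: lime_ge; first by apply/cvg_ex; exists c%:E.
by apply: nearW => N; exact: key.
Qed.

(** The half of the ergodic theorem that the theorem rests on: visits to [C]
grow at least at every linear rate smaller than [mu C]. If this failed on a set
of positive measure, by ergodicity it would fail almost everywhere, and then
almost every point would see too few visits at some time, against
[mean_le_of_visits]. *)
Lemma visits_lower (C : set T) (c : R) :
  ergodic_law mu f -> measurable C -> (c%:E < mu C)%E ->
  \forall u \ae mu, exists B : nat, forall n,
    c * n%:R <= (visits f C n u)%:R + B%:R.
Proof.
move=> erg mC cC.
have [c0|c0] := ltP c 0.
  by apply: aeW => u; exists 0%N => n; rewrite addr0 (@le_trans _ _ 0)// nmulr_rle0.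
have c1 : c <= 1.
  by rewrite -lee_fin (le_trans (ltW cC))// probability_le1.
(* The points from which the visits never fall short of the rate [c] by an
   unbounded amount: unlike sets defined by limits of averages at a fixed
   level, this one is exactly invariant. *)
pose G := \bigcup_B \bigcap_n
  [set u : T | c * n%:R <= (visits f C n u)%:R + B%:R].
have mG : measurable G.
  apply: bigcupT_measurable => B; apply: bigcapT_measurable => n.
  rewrite -[X in measurable X]setTI; apply: measurable_fun_le => //.
  by apply: measurable_funD => //; exact: measurable_visits.
have invG : f @^-1` G = G.
  apply/seteqP; split => u [B _ hB]; exists (B + 2)%N => // -[_|n _] /=.
  - by rewrite mulr0 addr_ge0.
  - have /= := hB n I; rewrite -add1n visits_add !natrD /=.
    have : 0 <= ((visits f C 1 u)%:R : R) by [].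
    by lra.
  - by rewrite mulr0 addr_ge0.
  - have /= := hB n.+2 I; rewrite -add1n visits_add !natrD /=.
    have : ((visits f C 1 u)%:R : R) <= 1 by rewrite lern1 visits_le.
    by lra.
have [G0|G1] := erg G mG invG; last first.
  have : mu.-negligible (~` G).
    have GC0 : mu (~` G) = 0%E by rewrite probability_setC// G1 subee.
    by apply/negligibleP => //; exact: measurableC.
  by apply: negligibleS; apply: subsetC => u [B _ hB]; exists B => n; exact: hB.
suff : (mu C <= c%:E)%E by rewrite leNgt cC.
apply: mean_le_of_visits => //.
have : mu.-negligible G by exact/negligibleP.
apply: negligibleS => u /= hu; exists 0%N => // n _ /=.
by rewrite addr0 leNgt; apply/negP => h; apply: hu; exists n.
Qed.
End ergodic.

(** * A Chernoff bound for Bernoulli words *)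

(** From [expR (- x) >= 1 - x] and [(1 - x) * (1 + x + 2 * x ^+ 2) >= 1]. *)
Lemma expR_le_quadratic {R : realType} (x : R) :
  x <= 2^-1 -> expR x <= 1 + x + 2 * x ^+ 2.
Proof.
move=> x12; have x1 : 0 < 1 - x by lra.
rewrite -(ler_pM2r x1); apply: (@le_trans _ _ 1).
  rewrite -[leRHS](expRxMexpNx_1 x) ler_wpM2l ?expR_ge0//.
  exact: expR_ge1Dx.
have : 0 <= x ^+ 2 * (1 - 2 * x) by rewrite mulr_ge0 ?sqr_ge0//; lra.
by rewrite expr2; nra.
Qed.

Definition bit_prob {R : realType} (p : R) (b : bool) : R := if b then p else 1 - p.

(** The centred contribution to a Hamming distance of one place, where [c] is
the noise-free difference of two bits and [e] the noise: for a Bernoulli [e],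
the bit [c != e] has mean [p + (1 - 2 * p) * c]. *)
Definition bit_dev {R : realType} (p : R) (c e : bool) : R :=
  (c != e)%:R - p - (1 - 2 * p) * c%:R.

(** Since [bit_dev p c] is centred, only the quadratic term of the exponential
survives, and its variance [p * (1 - p)] is at most [1 / 4]. *)
Lemma bit_mgf_le {R : realType} (p s : R) (c : bool) : 0 <= p <= 1 ->
  0 <= s <= 2^-1 ->
  \sum_(b : bool) bit_prob p b * expR (- s * bit_dev p c b) <= expR (s ^+ 2).
Proof.
move=> /andP[p0 p1] /andP[s0 s1].
have sp : 0 <= s * p by exact: mulr_ge0.
have sp1 : 0 <= s * (1 - p) by apply: mulr_ge0 => //; lra.
have ub b : bit_prob p b * expR (- s * bit_dev p c b) <=
    bit_prob p b *
    (1 + (- s * bit_dev p c b) + 2 * (- s * bit_dev p c b) ^+ 2).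
  apply: ler_wpM2l; first by case: b => /=; lra.
  by apply: expR_le_quadratic; rewrite /bit_dev; case: c; case: b => /=; lra.
apply: (le_trans (ler_sum _ (fun b _ => ub b))).
rewrite big_bool /=; apply: (le_trans _ (expR_ge1Dx _)).
have pp : p * (1 - p) <= 4^-1 by have := sqr_ge0 (p - 2^-1); lra.
rewrite /bit_dev /bit_prob /=; case: (c) => /=.
  rewrite [leLHS](_ : _ = 1 + 2 * s ^+ 2 * (p * (1 - p))); last by ring.
  by have := ler_wpM2l (sqr_ge0 s) pp; have := sqr_ge0 s; lra.
rewrite [leLHS](_ : _ = 1 + 2 * s ^+ 2 * (p * (1 - p))); last by ring.
by have := ler_wpM2l (sqr_ge0 s) pp; have := sqr_ge0 s; lra.
Qed.

(** Exponential Markov inequality with parameter [s = t / 2]: the sum over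
noise words factors into a product over places, each factor being bounded by
[bit_mgf_le]. *)
Lemma chernoff {R : realType} (p t : R) n (c : 'I_n -> bool) : 0 <= p <= 1 ->
  0 <= t <= 1 ->
  \sum_(e : {ffun 'I_n -> bool} | \sum_k bit_dev p (c k) (e k) < - (t * n%:R))
    \prod_k bit_prob p (e k) <= expR (- (t ^+ 2 / 4) * n%:R).
Proof.
move=> p01 t01; pose s := t / 2.
have s01 : 0 <= s <= 2^-1 by rewrite /s; lra.
have q0 (e : {ffun 'I_n -> bool}) : 0 <= \prod_k bit_prob p (e k).
  by apply: prodr_ge0 => k _; rewrite /bit_prob; case: (e k); lra.
apply: (@le_trans _ _ (expR (- s * t * n%:R) *
    \sum_(e : {ffun 'I_n -> bool})
       \prod_k (bit_prob p (e k) * expR (- s * bit_dev p (c k) (e k))))).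
  rewrite big_mkcond mulr_sumr; apply: ler_sum => e _.
  rewrite [X in _ <= _ * X]big_split/= mulrCA -expR_sum -mulr_sumr -expRD.
  case: ifPn => [h|_]; last by rewrite mulr_ge0// expR_ge0.
  rewrite ler_peMr// -[leLHS]expR0 ler_expR.
  have /andP[s0 _] := s01.
  set D := \sum_k _ in h *.
  have : 0 <= s * (- (t * n%:R) - D) by apply: mulr_ge0 => //; lra.
  lra.
rewrite -(bigA_distr_bigA
  (fun k b => bit_prob p b * expR (- s * bit_dev p (c k) b)))/=.
have ub : \prod_(k < n) \sum_(b : bool) bit_prob p b * expR (- s * bit_dev p (c k) b)
    <= \prod_(k < n) expR (s ^+ 2).
  apply: ler_prod => k _; rewrite bit_mgf_le// andbT sumr_ge0// => b _.
  by rewrite mulr_ge0 ?expR_ge0// /bit_prob; case: b; lra.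
rewrite (le_trans (ler_wpM2l (expR_ge0 _) ub))//.
rewrite -expR_sum sumr_const card_ord -expRD ler_expR -mulr_natr /s.
by rewrite le_eqVlt; apply/orP; left; apply/eqP; field.
Qed.

(** * Cylinders and subadditive sequences *)

(** The cylinder of [a]; it is a set in the Cantor space so that it can serve as
a neighbourhood. *)
Definition agree (n : nat) (a : nat -> bool) : set cantor_space :=
  [set b | forall k, (k < n)%N -> b k = a k].

Lemma nbhs_agree (n : nat) (a : cantor_space) : nbhs a (agree n a).
Proof.
elim: n => [|n IH]; first exact: filterS filterT.
have H : nbhs a [set b : cantor_space | b n = a n].
  exact: (@proj_continuous nat (fun=> bool) n a _ (discrete_set1 (a n))).
apply: filterS2 IH H => b hb bn k; rewrite ltnS leq_eqVlt.
by case/predU1P => [->//|/hb].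
Qed.

Lemma nbhs_cantorP (a : cantor_space) (B : set cantor_space) :
  nbhs a B <-> exists n, agree n a `<=` B.
Proof.
split=> [aB|[n]]; last by move/filterS; apply; exact: nbhs_agree.
have FF : Filter (filter_from [set: nat] (agree ^~ a)).
  apply: filter_from_filter; first by exists 0%N.
  move=> i j _ _; exists (maxn i j) => // b hb.
  by split=> k kn; apply: hb; rewrite leq_max kn ?orbT.
suff /(_ _ aB) [n _ nB] : filter_from [set: nat] (agree ^~ a) --> a.
  by exists n.
apply/cvg_sup => i U [_ [[W oW <-] Wa] WU].
by exists i.+1 => // b hb; apply: WU; rewrite /= hb.
Qed.

(** Fekete's subadditive lemma: with [n = q * m.+1 + r], subadditivity bounds
[a n / n] by [a m.+1 / m.+1] up to a term of order [1 / n], so the ratios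
converge to their infimum. *)
Lemma fekete {R : realType} (a : nat -> R) :
  (forall n, 0 <= a n) -> (forall m n, a (m + n)%N <= a m + a n) ->
  cvgn (fun n => n%:R^-1 * a n).
Proof.
move=> a0 aD.
have aM q m : a (q * m)%N <= q%:R * a m + a 0%N.
  elim: q => [|q IH]; first by rewrite !mul0n mul0r add0r.
  rewrite mulSn (le_trans (aD _ _))// -natr1 mulrDl mul1r; lra.
pose S := [set n.+1%:R^-1 * a n.+1 | n in [set: nat]].
have S0 : has_inf S.
  split; first by exists (1%:R^-1 * a 1%N), 0%N.
  by exists 0 => _ [n _ <-]; rewrite mulr_ge0.
apply/cvg_ex; exists (inf S); apply/cvgrPdist_le => /= e e0.
have e20 : 0 < e / 2 by rewrite divr_gt0.
have [_ [m _ <-] mS] := inf_adherent e20 S0.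
set M := a 0%N + \sum_(r < m.+1) a r.
near=> n.
have n0 : (0 < n)%N by near: n; exact: nbhs_infty_gt.
have nR : 0 < n%:R :> R by rewrite ltr0n.
have lo : inf S <= n%:R^-1 * a n.
  by apply: ge_inf => //; [exact: S0.2|exists n.-1; rewrite ?prednK].
rewrite distrC ger0_norm ?subr_ge0//.
move: mS; set r := m.+1%:R^-1 * a m.+1 => mS.
suff : n%:R^-1 * a n <= r + e / 2 by lra.
rewrite ler_pdivrMl// {mS}/r.
have hM : M <= n%:R * (e / 2).
  rewrite -ler_pdivrMr//; near: n; exact: nbhs_infty_ger.
rewrite mulrDr; apply: le_trans (lerD (lexx _) hM).
rewrite {1}(divn_eq n m.+1) (le_trans (aD _ _))//.
have aM' := aM (n %/ m.+1)%N m.+1.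
have ar : a (n %% m.+1)%N <= \sum_(r < m.+1) a r.
  have rm : (n %% m.+1 < m.+1)%N by rewrite ltn_mod.
  by rewrite (bigD1 (Ordinal rm))//= lerDl sumr_ge0.
have qa : (n %/ m.+1)%:R * a m.+1 <= n%:R * (m.+1%:R^-1 * a m.+1).
  rewrite mulrA ler_wpM2r// ler_pdivlMr ?ltr0n// -natrM ler_nat.
  exact: leq_trunc_div.
by rewrite (le_trans (lerD aM' ar))// /M addrA !lerD2r.
Unshelve. all: by end_near. Qed.

(** * Label sequences and their entropy *)

Section labels.
Context {R : realType} {Theta : pmetricType R} {U : ptopologicalType}.
Variables (F : Theta -> U -> U) (pi : U -> bool).

Lemma lab_shift th u m k :
  lab F pi th (iter m (F th) u) k = lab F pi th u (m + k).
Proof. by rewrite /lab -iterD addnC. Qed.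

Lemma label_closureP (a : cantor_space) : label_closure F pi a <->
  forall n, exists th u, agree n a (lab F pi th u).
Proof.
split=> [ca n|H B /nbhs_cantorP[n nB]].
  by have [_ [[th [u ->]] h]] := ca _ (nbhs_agree n a); exists th, u.
have [th [u h]] := H n.
by exists (lab F pi th u); split; [exists th, u|exact: nB].
Qed.

Lemma label_graphP th (a : cantor_space) : label_graph F pi (th, a) <->
  forall n (e : R), 0 < e ->
    exists th' u, ball th e th' /\ agree n a (lab F pi th' u).
Proof.
split=> [ca n e e0|H B [[B1 B2] /= [/nbhs_ballP[e /= e0 eB] /nbhs_cantorP[n nB]]] B12].
  have hn : nbhs (th, a) (ball th e `*` agree n a).
    exists (ball th e, agree n a) => //.
    by split => /=; [exact: nbhsx_ballx|exact: nbhs_agree].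
  have [_ [[th' [u ->]] [h1 h2]]] := ca _ hn.
  by exists th', u.
have [th' [u [h1 h2]]] := H n e e0.
exists (th', lab F pi th' u); split; first by exists th', u.
by apply: B12; split => /=; [exact: eB|exact: nB].
Qed.

(** A shifted label sequence is the label sequence of a later point of the
orbit. *)
Lemma label_closure_shift m (a : cantor_space) : label_closure F pi a ->
  label_closure F pi (fun k => a (m + k)%N).
Proof.
move=> /label_closureP ca; apply/label_closureP => n.
have [th [u h]] := ca (m + n)%N; exists th, (iter m (F th) u) => k kn.
by rewrite lab_shift h// ltn_add2l.
Qed.

Lemma label_wordP n (w : n.-tuple bool) : w \in label_words F pi n <->
  exists2 a, label_closure F pi a & w = [tuple a i | i < n].
Proof. by rewrite /label_words finset.inE; split => /asboolP. Qed.

Lemma card_label_words_gt0 n : (0 < #|label_words F pi n|)%N.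
Proof.
apply/card_gt0P; exists [tuple lab F pi point point i | i < n].
apply/label_wordP; exists (lab F pi point point) => //.
by apply/label_closureP => m; exists point, point.
Qed.

(** Both halves of a label word are label words, the second one by
shift-invariance of the closure. *)
Lemma card_label_words_add m n : (#|label_words F pi (m + n)| <=
  #|label_words F pi m| * #|label_words F pi n|)%N.
Proof.
rewrite -cardsX.
pose g (w : (m + n).-tuple bool) : m.-tuple bool * n.-tuple bool :=
  ([tuple tnth w (lshift n i) | i < m], [tuple tnth w (rshift m i) | i < n]).
have gI : injective g.
  move=> v w /[dup] /(congr1 fst) h1 /(congr1 snd) h2; apply: eq_from_tnth => i.
  have e1 j : tnth v (lshift n j) = tnth w (lshift n j).
    have := congr1 (fun s : m.-tuple bool => tnth s j) h1.
    by rewrite !tnth_mktuple.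
  have e2 j : tnth v (rshift m j) = tnth w (rshift m j).
    have := congr1 (fun s : n.-tuple bool => tnth s j) h2.
    by rewrite !tnth_mktuple.
  by case: (split_ordP i) => j ->.
rewrite -(card_imset _ gI); apply: subset_leq_card; apply/fintype.subsetP => x.
case/imsetP => w /label_wordP[a ca ->] ->; rewrite finset.inE /=.
apply/andP; split; apply/label_wordP.
- exists a => //; apply: eq_from_tnth => i.
  by rewrite !tnth_mktuple.
- exists (fun k => a (m + k)%N); first exact: label_closure_shift.
  by apply: eq_from_tnth => i; rewrite !tnth_mktuple.
Qed.

(** The operator [limn] returns [0] on divergent sequences as well, so a zero
entropy says something about word counts only because Fekete's lemma shows that
the limit exists. *)
Lemma card_label_words_entropy0 (s : R) : entropy F pi = 0 -> 0 < s ->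
  \forall n \near \oo, (#|label_words F pi n|%:R : R) <= expR (s * n%:R).
Proof.
move=> h0 s0.
pose a n := ln (#|label_words F pi n|%:R : R).
have cpos n : 0 < (#|label_words F pi n|%:R : R).
  by rewrite ltr0n card_label_words_gt0.
have cv : cvgn (fun n => n%:R^-1 * a n).
  apply: fekete => [n|m n].
    by rewrite ln_ge0// ler1n card_label_words_gt0.
  rewrite -lnM ?posrE// ler_ln ?posrE ?mulr_gt0// -natrM ler_nat.
  exact: card_label_words_add.
have /cvgrPdist_lt/(_ s s0) : (fun n => n%:R^-1 * a n) @ \oo --> (0 : R).
  by rewrite -h0.
apply: filterS2 (nbhs_infty_gt 0) => n n0.
rewrite sub0r normrN => /(le_lt_trans (ler_norm _)).
rewrite ltr_pdivrMl ?ltr0n// mulrC => /ltW h.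
by rewrite -[leLHS]lnK ?posrE// ler_expR.
Qed.

End labels.

(** * Mismatches and recurring words *)

(** When [w] never occurs in [b], every occurrence of [w] in [a] contains a
place where [a] and [b] differ, and each such place lies in at most [m] windows
of length [m]. The second summand [m] pays for the windows that stick out of
the first [n] places. *)
Lemma count_occurrences_le (m n : nat) (a b w : nat -> bool) :
  (forall k, ~ agree m w (fun i => b (k + i)%N)) ->
  (\sum_(k < n) (`[< agree m w (fun i => a (k + i)%N) >] : nat) <=
     m * (\sum_(j < n) (b j != a j : nat) + m))%N.
Proof.
move=> hb.
have shift i : (i < m)%N ->
    (\sum_(k < n) (b (k + i) != a (k + i) : nat) <=
       \sum_(j < n) (b j != a j : nat) + m)%N.
  move=> im; pose g j := (b j != a j : nat).
  have [e1 e2] : \sum_(j < i + n) g j = (\sum_(j < i) g j + \sum_(k < n) g (k + i)%N)%N /\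
      \sum_(j < n + i) g j = (\sum_(j < n) g j + \sum_(k < i) g (n + k)%N)%N.
    split; rewrite big_split_ord//=; congr addn.
    by apply: eq_bigr => k _; rewrite addnC.
  apply: (@leq_trans (\sum_(j < i + n) g j)%N); first by rewrite e1 leq_addl.
  rewrite addnC e2 leq_add2l (leq_trans _ (ltnW im))//.
  by rewrite -[leqRHS]card_ord -sum1_card; apply: leq_sum => k _; exact: leq_b1.
apply: (@leq_trans (\sum_(i < m) \sum_(k < n) (b (k + i) != a (k + i) : nat))).
  rewrite exchange_big /=; apply: leq_sum => k _.
  have [/= ak|//] := asboolP.
  have [i [im bi]] : exists i, (i < m)%N /\ b (k + i)%N <> w i.
    apply: contrapT => h; apply: (hb k) => i im /=.
    by apply: contrapT => bi; apply: h; exists i.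
  rewrite (bigD1 (Ordinal im))//= ak//.
  by case: eqP.
apply: (@leq_trans (\sum_(i < m) (\sum_(j < n) (b j != a j : nat) + m))).
  by apply: leq_sum => i _; exact: shift.
by rewrite sum_nat_const card_ord.
Qed.

Lemma ereal_cvg0 {R : realType} (u : nat -> \bar R) : (forall n, 0 <= u n)%E ->
  (forall e : R, 0 < e -> \forall n \near \oo, (u n <= e%:E)%E) ->
  u n @[n --> \oo] --> 0%E.
Proof.
move=> u0 ue; apply/fine_cvgP; split.
  apply: filterS (ue 1 ltr01) => n un.
  by rewrite ge0_fin_numE// (le_lt_trans un)// ltry.
apply/cvgrPdist_le => e e0; apply: filterS (ue e e0) => n un /=.
rewrite sub0r normrN ger0_norm ?fine_ge0//.
by rewrite -lee_fin fineK// ge0_fin_numE// (le_lt_trans un)// ltry.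
Qed.

(** In a compact space a sequence staying away from [S] infinitely often would
have an accumulation point at positive distance from [S], hence outside [S]. *)
Lemma edist_inf_cvg0_of_cluster {R : realType} {Theta : pmetricType R}
    (S : set Theta) (th : nat -> Theta) : compact [set: Theta] ->
  (forall t, (forall e : R, 0 < e -> forall N, exists2 n, (N <= n)%N &
     ball t e (th n)) -> S t) ->
  edist_inf S (th n) @[n --> \oo] --> 0%E.
Proof.
move=> cT hS; apply: ereal_cvg0 => [n|e e0]; first exact: edist_inf_ge0.
apply: contrapT => hn.
have /choice[g hg] : forall N, exists n, (N <= n)%N /\ (e%:E < edist_inf S (th n))%E.
  move=> N; apply: contrapT => h; apply: hn; exists N => // n /= Nn.
  by rewrite leNgt; apply/negP => hlt; apply: h; exists n.
have [t [_ ct]] := cT (th (g N) @[N --> \oo]) _ filterT.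
have near_t r : 0 < r -> forall N, exists2 n, (N <= n)%N & ball t r (th (g n)).
  move=> r0 N.
  have hN : (th (g n) @[n --> \oo]) [set th (g n) | n in [set n | (N <= n)%N]].
    by exists N => // n /= Nn; exists n.
  have [_ [[n /= Nn <-] tn]] := ct _ _ hN (nbhsx_ballx t r r0).
  by exists n.
have St : S t.
  apply: hS => r r0 N; have [n Nn tn] := near_t r r0 N.
  by exists (g n) => //; rewrite (leq_trans Nn)//; exact: (hg n).1.
have [n _ tn] := near_t e e0 0%N.
have := (hg n).2; rewrite ltNge => /negP; apply.
apply: (@le_trans _ _ (edist (th (g n), t))).
  by apply: ereal_inf_lbound; exists t.
by apply: edist_fin => //=; exact: ball_sym.
Qed.

Section mismatch_theory.
Context {R : realType} {Theta : pmetricType R} {U : ptopologicalType}.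
Variables (F : Theta -> U -> U) (pi : U -> bool).

Lemma mismatch_ge0 n y th u : 0 <= mismatch F pi n y th u :> R.
Proof. by rewrite /mismatch mulr_ge0// sumr_ge0. Qed.

Lemma has_inf_mismatch n y th : has_inf (range (mismatch F pi n y th)).
Proof.
split; first by exists (mismatch F pi n y th point), point.
by exists 0 => _ [u _ <-]; exact: mismatch_ge0.
Qed.

Lemma min_mismatch_le n y th u :
  min_mismatch F pi n y th <= mismatch F pi n y th u.
Proof. by apply: ge_inf; [exact: (has_inf_mismatch n y th).2|exists u]. Qed.

Lemma min_mismatch_ge n y th c : (forall u, c <= mismatch F pi n y th u) ->
  c <= min_mismatch F pi n y th.
Proof.
move=> h; apply: lb_le_inf; first exact: (has_inf_mismatch n y th).1.
by move=> _ [u _ <-].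
Qed.

Lemma min_mismatch_ge0 n y th : 0 <= min_mismatch F pi n y th.
Proof. by apply: min_mismatch_ge => u; exact: mismatch_ge0. Qed.

Lemma global_min_mismatch_le n y th :
  global_min_mismatch F pi n y <= min_mismatch F pi n y th.
Proof.
apply: ge_inf; last by exists th.
by exists 0 => _ [t _ <-]; exact: min_mismatch_ge0.
Qed.

Lemma global_min_mismatch_ge n y c :
  (forall th u, c <= mismatch F pi n y th u) -> c <= global_min_mismatch F pi n y.
Proof.
move=> h; apply: lb_le_inf; first by exists (min_mismatch F pi n y point), point.
by move=> _ [th _ <-]; exact: min_mismatch_ge.
Qed.

Lemma eq_mismatch n y y' th u : (forall k, (k < n)%N -> y k = y' k) ->
  mismatch F pi n y th u = mismatch F pi n y' th u.
Proof.
by move=> yy; congr (_ * _); apply: eq_bigr => k _; rewrite yy.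
Qed.

Lemma eq_min_mismatch n y y' th : (forall k, (k < n)%N -> y k = y' k) ->
  min_mismatch F pi n y th = min_mismatch F pi n y' th.
Proof.
move=> yy; rewrite /min_mismatch.
suff -> : mismatch F pi n y th = mismatch F pi n y' th by [].
by apply/funext => u; exact: eq_mismatch yy.
Qed.

Lemma mismatchE n y th u : mismatch F pi n y th u =
  n%:R^-1 * (\sum_(k < n) (lab F pi th u k != y k : nat))%N%:R.
Proof. by rewrite /mismatch natr_sum. Qed.

(** If no label sequence of a parameter in [ball t e] started with [w], then, as
orbits can be started anywhere, none would contain [w] at all, and the positive
frequency [c] of [w] in [a] would force a mismatch of about [c / m] whenever
[th n] is in the ball. *)
Lemma recurrent_word_near (a w : nat -> bool) (m B : nat) (c : R)
    (th : nat -> Theta) (t : Theta) : 0 < c ->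
  (forall n, c * n%:R <=
     (\sum_(k < n) (`[< agree m w (fun i => a (k + i)%N) >] : nat))%N%:R + B%:R) ->
  min_mismatch F pi n a (th n) @[n --> \oo] --> (0 : R) ->
  (forall e : R, 0 < e -> forall N, exists2 n, (N <= n)%N & ball t e (th n)) ->
  forall e : R, 0 < e ->
    exists th' u, ball t e th' /\ agree m w (lab F pi th' u).
Proof.
move=> c0 freq mm clus e e0; apply: contrapT => hw.
(* Errors of density below eta spoil less than half of the occurrences. *)
pose eta := c / (2 * m.+1%:R).
have eta0 : 0 < eta by rewrite divr_gt0// mulr_gt0.
have /cvgrPdist_lt/(_ eta eta0)[N1 _ hN1] := mm.
pose N2 := (Num.truncn (((m * m + B)%:R : R) / (c / 2))).+1.
have [n Nn tn] := clus e e0 (maxn N1 N2.+1).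
move: Nn; rewrite geq_max => /andP[n1 n2].
have n0 : (0 < n)%N by exact: leq_trans n2.
have nR : 0 < n%:R :> R by rewrite ltr0n.
have := hN1 n n1; rewrite /= sub0r normrN ger0_norm ?min_mismatch_ge0//.
move=> /inf_lt [|_ [u _ <-]]; first exact: (has_inf_mismatch _ _ _).1.
rewrite mismatchE ltr_pdivrMl//; set D := (\sum_(k < n) _)%N => hD.
have cnt := count_occurrences_le m n a (lab F pi (th n) u) w _.
have /cnt : forall k, ~ agree m w (fun i => lab F pi (th n) u (k + i)%N).
  move=> k hk; apply: hw; exists (th n), (iter k (F (th n)) u); split => //.
  by move=> i im; rewrite lab_shift hk.
rewrite -/D -(ler_nat R) => hc.
have := le_trans (freq n) (lerD hc (lexx _)).
rewrite natrM natrD.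
have : (((m * m + B)%:R : R) < n%:R * (c / 2)).
  rewrite -ltr_pdivrMr ?divr_gt0//; apply: lt_le_trans (truncnS_gt _) _.
  by rewrite ler_nat ltnW.
have : m%:R * D%:R <= n%:R * (c / 2).
  have mm1 : (m%:R : R) <= m.+1%:R by rewrite ler_nat.
  have : m.+1%:R * D%:R <= m.+1%:R * (n%:R * eta) by rewrite ler_wpM2l// ltW.
  rewrite (_ : m.+1%:R * (n%:R * eta) = n%:R * (c / 2)); last first.
    have : (m.+1%:R : R) != 0 by rewrite pnatr_eq0.
    by rewrite /eta; move: (m.+1%:R : R) => M M0; field.
  apply: le_trans; exact: ler_wpM2r.
rewrite natrD natrM; lra.
Qed.

End mismatch_theory.

(** * Finite words and almost sure events *)

Definition word (n : nat) (a : nat -> bool) : n.-tuple bool :=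
  [tuple a i | i < n].

Lemma word_eqP n (a b : nat -> bool) : word n a = word n b <-> agree n b a.
Proof.
split=> [h k kn|h].
  have := congr1 (fun s : n.-tuple bool => tnth s (Ordinal kn)) h.
  by rewrite !tnth_mktuple.
by apply: eq_from_tnth => i; rewrite !tnth_mktuple; exact: h.
Qed.

Lemma nth_word n (a : nat -> bool) k : (k < n)%N -> nth false (word n a) k = a k.
Proof. by move=> kn; rewrite -(tnth_nth false (word n a) (Ordinal kn)) tnth_mktuple. Qed.

Lemma word_nth n (v : n.-tuple bool) : word n (nth false v) = v.
Proof. by apply: eq_from_tnth => i; rewrite tnth_mktuple (tnth_nth false). Qed.

Lemma measurable_preimage_fin {d : measure_display} {T : measurableType d}
    {V : finType} (f : T -> V) :
  (forall v, measurable (f @^-1` [set v])) ->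
  forall D : set V, measurable (f @^-1` D).
Proof.
move=> mf D; rewrite (_ : f @^-1` D = \bigcup_(v in D) f @^-1` [set v]).
  by apply: fin_bigcup_measurable => // v _; exact: mf.
by apply/seteqP; split=> [t Dt|t [v Dv /= ->]//]; exists (f t).
Qed.

Lemma measure_le_fin_sum {d : measure_display} {T : measurableType d}
    {R : realType} (mu : {measure set T -> \bar R}) {I : finType} (Q : pred I)
    (A : I -> set T) (B : set T) :
  measurable B -> (forall i, measurable (A i)) ->
  (forall x, B x -> exists2 i, Q i & A i x) ->
  (mu B <= \sum_(i | Q i) mu (A i))%E.
Proof.
move=> mB mA BA.
have mU (s : seq I) : measurable (\big[setU/set0]_(i <- s | Q i) A i).
  by apply: bigsetU_measurable.
apply: (@le_trans _ _ (mu (\big[setU/set0]_(i | Q i) A i))).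
  apply: le_measure; rewrite ?inE//.
  by move=> x /BA[i Qi Aix]; rewrite (bigD1 i)//=; left.
elim: (index_enum I) => [|i s IH]; first by rewrite !big_nil measure0.
have := mU s; rewrite !big_cons; case: ifP => // Qi ms.
by rewrite (le_trans (measureU2 _ (mA i) ms))// leeD2l.
Qed.

Lemma ae_forall_count {d : measure_display} {T : measurableType d}
    {R : realType} (mu : {measure set T -> \bar R}) {I : countType}
    (Q : I -> T -> Prop) :
  (forall i, \forall x \ae mu, Q i x) -> \forall x \ae mu, forall i, Q i x.
Proof.
move=> hQ; have : \forall x \ae mu, forall n,
    (if @choice.unpickle I n is Some i then Q i x else True).
  by apply: ae_foralln => n; case: (@choice.unpickle I n) => [i|]; [exact: hQ|exact: aeW].
by apply: filterS => x h i; have := h (choice.pickle i); rewrite choice.pickleK.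
Qed.

Lemma ae_distribution {d d' : measure_display} {T : measurableType d}
    {S : measurableType d'} {R : realType} (P : probability T R)
    (X : {RV P >-> S}) (Q : S -> Prop) :
  (\forall x \ae distribution P X, Q x) -> \forall w \ae P, Q (X w).
Proof.
move=> [N [mN N0 QN]]; exists (X @^-1` N); split => //.
- by rewrite -[X in measurable X]setTI; exact: measurable_funPT.
- by move=> w /= h; exact: QN.
Qed.

Lemma borel_cantelli {d : measure_display} {T : measurableType d}
    {R : realType} (P : probability T R) (A : nat -> set T) (c r : R) :
  (forall n, measurable (A n)) -> 0 <= c -> 0 < r < 1 ->
  (\forall n \near \oo, (P (A n) <= (c * r ^+ n)%:E)%E) ->
  \forall w \ae P, \forall n \near \oo, ~ A n w.
Proof.
move=> mA c0 /andP[r0 r1] [N _ hN].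
have rn : `|r| < 1 by rewrite gtr0_norm.
have lim0 : P (lim_sup_set (fun n => A (n + N)%N)) = 0%E.
  apply: lim_sup_set_cvg0 => [k//|].
  apply: (@le_lt_trans _ _ (c / (1 - r))%:E); last exact: ltry.
  apply: lime_le; first exact: is_cvg_nneseries.
  apply: nearW => n.
  apply: (@le_trans _ _ (\sum_(0 <= k < n) (geometric c r k)%:E)%E).
    apply: lee_sum => k _; apply: le_trans (hN _ (leq_addl _ _)) _.
    rewrite lee_fin /= ler_wpM2l// ler_wiXn2l ?ltW// leq_addr//.
  by rewrite sumEFin lee_fin; exact: geometric_le_lim.
have mL : measurable (lim_sup_set (fun n => A (n + N)%N)).
  by apply: bigcapT_measurable => k; apply: bigcup_measurable => *.
have : P.-negligible (lim_sup_set (fun n => A (n + N)%N)) by exact/negligibleP.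
apply: negligibleS => w /= hw k _ /=; apply: contrapT => h; apply: hw.
exists (k + N)%N => // n /= kn An; apply: h; exists (n - N)%N => /=; first lia.
by rewrite subnK//; lia.
Qed.

Lemma probability1_ae {d : measure_display} {T : measurableType d}
    {R : realType} (P : probability T R) (A : set T) : measurable A ->
  P A = 1%E <-> \forall x \ae P, A x.
Proof.
move=> mA; have mAC : measurable (~` A) by exact: measurableC.
split=> [A1|/negligibleP A0].
  have AC0 : P (~` A) = 0%E by rewrite probability_setC// A1 subee.
  exact/negligibleP.
by rewrite -(setCK A) probability_setC// A0 ?sube0.
Qed.

(** * Noise-free labels *)

Section model.
Context {R : realType} {U : ptopologicalType} {Theta : pmetricType R}.
Context (F : Theta -> U -> U) (pi : U -> bool) (th0 : Theta).
Context {d : measure_display} {Omega : measurableType d}.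
Context (P : probability Omega R) (X : {RV P >-> borel U}).
Hypothesis mF : measurable_fun [set: borel U] (F th0 : borel U -> borel U).
Hypothesis mpi : forall b, measurable ([set u | pi u = b] : set (borel U)).

Let clean (w : Omega) : nat -> bool := lab F pi th0 (X w).

Definition cylinder (n : nat) (a : nat -> bool) : set (borel U) :=
  [set u | agree n a (lab F pi th0 u)].

Lemma measurable_cylinder n a : measurable (cylinder n a).
Proof.
rewrite (_ : cylinder n a =
    \bigcap_(k in `I_n) (iter k (F th0) @^-1` [set u | pi u = a k])); last first.
  by apply/seteqP; split=> u h k; exact: h.
apply: bigcap_measurableType => k _.
by apply: (measurable_preimage_iter _ mF); exact: mpi.
Qed.

Lemma measurable_X (A : set (borel U)) : measurable A -> measurable (X @^-1` A).
Proof. by move=> mA; rewrite -[X in measurable X]setTI; exact: measurable_funPT. Qed.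

Lemma measurable_word n (D : set (n.-tuple bool)) :
  measurable [set w | D (word n (clean w))].
Proof.
apply: (measurable_preimage_fin (fun w => word n (clean w))) => v.
rewrite (_ : _ @^-1` _ = X @^-1` cylinder n (nth false v)).
  exact: measurable_X (measurable_cylinder _ _).
apply/seteqP; split=> w /= h; first by apply/word_eqP; rewrite word_nth.
by move/word_eqP: h; rewrite word_nth.
Qed.

Hypothesis inv : invariant_law (distribution P X) (F th0).
Hypothesis erg : ergodic_law (distribution P X) (F th0).

Let prefix_law (s : seq bool) : \bar R :=
  distribution P X (cylinder (size s) (nth false s)).

(** There are countably many words, so the null cylinders have a null union. *)
Lemma label_prefix_gt0 : \forall w \ae P, forall s : seq bool,
  agree (size s) (nth false s) (clean w) -> (0 < prefix_law s)%E.
Proof.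
apply: ae_forall_count => s.
have [h|h] := eqVneq (prefix_law s) 0%E; last first.
  by apply: aeW => w _; rewrite lt_neqAle eq_sym h/= measure_ge0.
have : P.-negligible (X @^-1` cylinder (size s) (nth false s)).
  apply/negligibleP => //; exact: measurable_X (measurable_cylinder _ _).
by apply: negligibleS => w /= hw; apply: contrapT => hn; apply: hw => /hn.
Qed.

Lemma label_occurrences : \forall w \ae P, forall s : seq bool,
  (0 < prefix_law s)%E ->
  exists c : R, exists B : nat, 0 < c /\ forall n, c * n%:R <=
    (\sum_(k < n) (`[< agree (size s) (nth false s)
       (fun i => clean w (k + i)%N) >] : nat))%N%:R + B%:R.
Proof.
apply: ae_forall_count => s.
have [s0|s0] := pselect (0 < prefix_law s)%E; last by apply: aeW.
have sfin : prefix_law s \is a fin_num.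
  by apply: fin_num_measure; exact: measurable_cylinder.
pose c := fine (prefix_law s) / 2.
have f0 : 0 < fine (prefix_law s) by rewrite -lte_fin fineK.
have c0 : 0 < c by rewrite divr_gt0.
have cs : (c%:E < prefix_law s)%E.
  by rewrite -(fineK sfin) lte_fin /c; lra.
have := visits_lower _ _ mF inv _ _ erg (measurable_cylinder _ _) cs.
move=> /ae_distribution; apply: filterS => w [B hB] _.
exists c, B; split => // n; apply: le_trans (hB n) _.
rewrite lerD2r ler_nat; apply: eq_leq; apply: eq_bigr => k _.
congr nat_of_bool; apply/idP/idP.
  by rewrite inE => h; apply/asboolP => i im; rewrite -h// lab_shift.
by move=> /asboolP h; rewrite inE => i im; rewrite lab_shift; exact: h.
Qed.

(** Membership in a slice is a countable conjunction of conditions on finite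
words, which makes the event measurable and lets probability one be read as
holding almost everywhere. *)
Lemma label_slice_ae t :
  Theta1 F pi P th0 X t <-> \forall w \ae P, label_slice F pi t (clean w).
Proof.
pose S n (j : nat) : set (n.-tuple bool) := [set v | exists t' u,
  ball t (j.+1%:R^-1 : R) t' /\ agree n (nth false v) (lab F pi t' u)].
have sliceE : [set w | label_slice F pi t (clean w)] =
    \bigcap_n \bigcap_j [set w | S n j (word n (clean w))].
  apply/seteqP; split => w /=.
    move=> /label_graphP h n _ j _.
    have j0 : 0 < (j.+1%:R^-1 : R) by rewrite invr_gt0.
    have [t' [u [h1 h2]]] := h n _ j0.
    by exists t', u; split => // k kn; rewrite nth_word// h2.
  move=> h; apply/label_graphP => n e e0.
  have [t' [u [h1 h2]]] := h n I (Num.truncn e^-1) I.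
  exists t', u; split; last by move=> k kn; rewrite h2// nth_word.
  apply: le_ball h1; rewrite -[leRHS]invrK lef_pV2 ?posrE ?invr_gt0//.
  exact/ltW/truncnS_gt.
have mS : measurable [set w | label_slice F pi t (clean w)].
  rewrite sliceE; apply: bigcapT_measurable => n; apply: bigcapT_measurable => j.
  exact: measurable_word.
rewrite /Theta1 /= /label_law /pushforward.
exact: probability1_ae mS.
Qed.

(** The noise-free theorem: parameters explaining the labels up to a vanishing
proportion of errors approach [Theta1]. The exceptional null set does not depend
on the parameters, which may therefore be chosen as a function of the sample. *)
Lemma label_consistency : compact [set: Theta] -> \forall w \ae P,
  forall th : nat -> Theta,
    min_mismatch F pi n (clean w) (th n) @[n --> \oo] --> (0 : R) ->
    edist_inf (Theta1 F pi P th0 X) (th n) @[n --> \oo] --> 0%E.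
Proof.
move=> cT; apply: filterS label_occurrences => w occ th mm.
apply: edist_inf_cvg0_of_cluster => // t clus; apply/label_slice_ae.
apply: filterS label_prefix_gt0 => w' pos; apply/label_graphP => n e e0.
pose s : seq bool := word n (clean w').
have ss : size s = n by rewrite size_tuple.
have sa k : (k < n)%N -> nth false s k = clean w' k by exact: nth_word.
have /occ[c [B [c0 hB]]] : (0 < prefix_law s)%E.
  by apply: pos => k; rewrite ss => kn; rewrite sa.
have [t' [u [tt' hu]]] := recurrent_word_near F pi (clean w) (nth false s) (size s)
  B c th t c0 hB mm clus e e0.
by exists t', u; split => // k kn; rewrite hu ?ss// sa.
Qed.

(** * Controlling the noise *)

Context (p : R) (eps : nat -> {RV P >-> bool}).
Hypothesis hbern : forall k, distribution P (eps k) =1 bernoulli_prob p.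
Hypothesis hind : independent_family P (fun k => eps k : Omega -> bool).
Hypothesis hindX : independent P X
  (fun w => (fun k => eps k w) : borel cantor_space).
Hypothesis p01 : 0 <= p <= 1.

Lemma noise_bit k b : P (eps k @^-1` [set b]) = (bit_prob p b)%:E.
Proof.
rewrite -[LHS]/(distribution P (eps k) [set b]) hbern bernoulli_probE//.
have in1 x : (x \in [set b]) = (x == b) by apply/idP/eqP; rewrite inE.
rewrite !diracE !in1; case: b {in1} => /=;
  by rewrite ?mule1 ?mule0 ?adde0 ?add0e.
Qed.

Let noise n (w : Omega) : {ffun 'I_n -> bool} := [ffun i : 'I_n => eps i w].

Lemma noise_wordE n (e : {ffun 'I_n -> bool}) (b : nat -> bool) :
  (forall k : 'I_n, b k = e k) ->
  noise n @^-1` [set e] = [set w | forall k, (k < n)%N -> eps k w = b k].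
Proof.
move=> be; apply/seteqP; split=> w /=.
  move=> h k kn; have := congr1 (fun g : {ffun 'I_n -> bool} => g (Ordinal kn)) h.
  by rewrite ffunE => ->; rewrite -be.
by move=> h; apply/ffunP => k; rewrite ffunE h.
Qed.

Lemma noise_word n (e : {ffun 'I_n -> bool}) :
  P (noise n @^-1` [set e]) = (\prod_k bit_prob p (e k))%:E.
Proof.
pose b (k : nat) := if insub k is Some i then e i else false : bool.
have bE (k : 'I_n) : b k = e k by rewrite /b valK.
rewrite (noise_wordE n e b)//.
pose J := [fset k in iota 0 n]%fset.
have := hind J (fun k => [set b k]) (fun=> I).
rewrite (_ : \bigcap_(i in _) _ = [set w | forall k, (k < n)%N -> eps k w = b k]); last first.
  apply/seteqP; split=> w h k /=.
    by move=> kn; apply: h; rewrite /= !inE mem_iota.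
  by rewrite !inE mem_iota => /h.
move=> ->.
rewrite (eq_bigr (fun k => (bit_prob p (b k))%:E)); last by move=> k _; exact: noise_bit.
rewrite prodEFin; congr EFin.
rewrite (perm_big (iota 0 n)) /=; last first.
  apply: uniq_perm; rewrite ?iota_uniq ?fset_uniq// => k.
  by rewrite inE.
rewrite -{1}(subn0 n) -/(index_iota 0 n) big_mkord.
by apply: eq_bigr => k _; rewrite bE.
Qed.

Lemma measurable_noise n (e : {ffun 'I_n -> bool}) :
  measurable (noise n @^-1` [set e]).
Proof.
rewrite (_ : _ @^-1` _ = \bigcap_(k in [set: 'I_n]) (eps k @^-1` [set e k])).
  apply: fin_bigcap_measurable => // k _.
  by rewrite -[X in measurable X]setTI; exact: measurable_funPT.
apply/seteqP; split=> w /=; first by move=> <- k _ /=; rewrite ffunE.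
by move=> h; apply/ffunP => k; rewrite ffunE; exact: h.
Qed.

(** Independence of the noise from [X] restricted to finite words, which
reduces all conditioning on the labels to finite sums. *)
Lemma label_noise_word n (v : n.-tuple bool) (e : {ffun 'I_n -> bool}) :
  P ([set w | word n (clean w) = v] `&` (noise n @^-1` [set e])) =
  (P [set w | word n (clean w) = v] * (\prod_k bit_prob p (e k))%:E)%E.
Proof.
pose b (k : nat) := if insub k is Some i then e i else false : bool.
have bE (k : 'I_n) : b k = e k by rewrite /b valK.
rewrite -noise_word (noise_wordE n e b)//.
have -> : [set w | word n (clean w) = v] = X @^-1` cylinder n (nth false v).
  apply/seteqP; split=> w /= h; last by move/word_eqP: h; rewrite word_nth.
  by apply/word_eqP; rewrite word_nth.
have mB : measurable (agree n b : set (borel cantor_space)).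
  apply: sub_sigma_algebra; rewrite openE => c cb.
  apply: filterS (nbhs_agree n c) => c' h k kn.
  by rewrite h// cb.
exact: hindX (measurable_cylinder _ _) mB.
Qed.

(** The family [K] of words to be controlled may depend on the noise-free labels:
conditionally on these it is a fixed family of at most [N] words, to which the
union bound and [chernoff] apply. *)
Lemma chernoff_event n (t : R) (N : nat)
    (K : n.-tuple bool -> {set {ffun 'I_n -> bool}}) :
  (forall v, (#|K v| <= N)%N) -> 0 <= t <= 1 ->
  let Bad := [set w | exists2 c, c \in K (word n (clean w)) &
    \sum_k bit_dev p (c k) (noise n w k) < - (t * n%:R)] in
  measurable Bad /\ (P Bad <= (N%:R * expR (- (t ^+ 2 / 4) * n%:R))%:E)%E.
Proof.
move=> KN t01 Bad.
pose far (c e : {ffun 'I_n -> bool}) :=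
  \sum_k bit_dev p (c k) (e k) < - (t * n%:R).
pose V := n.-tuple bool; pose E := {ffun 'I_n -> bool}.
pose A (x : V * (E * E)) :=
  [set w | word n (clean w) = x.1] `&` (noise n @^-1` [set x.2.2]).
have mA x : measurable (A x).
  apply: measurableI; last exact: measurable_noise.
  exact: (measurable_word n [set x.1]).
have mBad : measurable Bad.
  have := @measurable_preimage_fin _ _ (V * E)%type
    (fun w => (word n (clean w), noise n w)) _
    [set x | exists2 c, c \in K x.1 & far c x.2].
  apply => -[v e].
  rewrite (_ : _ @^-1` _ = A (v, (e, e))); first exact: mA.
  by apply/seteqP; split=> w /=; [move=> [<- <-]|move=> [/= <- <-]].
split => //.
pose q (v : V) := fine (P [set w | word n (clean w) = v]).
have qE v : P [set w | word n (clean w) = v] = (q v)%:E.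
  by rewrite fineK//; apply: fin_num_measure; exact: (measurable_word n [set v]).
have q0 v : 0 <= q v by rewrite fine_ge0// measure_ge0.
have q1 : \sum_v q v = 1.
  apply: EFin_inj; rewrite -sumEFin.
  under eq_bigr do rewrite -qE.
  rewrite bigfs ?index_enum_uniq//; last by move=> i _; rewrite mem_index_enum.
  rewrite -measure_fin_bigcup//; first last.
  - by move=> v _; exact: (measurable_word n [set v]).
  - by move=> u v _ _ [w [/= <- <-]].
  rewrite (_ : \bigcup_(i in _) _ = setT); first exact: probability_setT.
  by apply/seteqP; split => // w _; exists (word n (clean w)).
apply: (@le_trans _ _ (\sum_(x | (x.2.1 \in K x.1) && far x.2.1 x.2.2) P (A x))%E).
  apply: measure_le_fin_sum => // w [c cK hc].
  by exists (word n (clean w), (c, noise n w)); first exact/andP.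
rewrite (eq_bigr (fun x : V * (E * E) => (q x.1 * \prod_k bit_prob p (x.2.2 k))%:E)); last first.
  by move=> x _; rewrite /A label_noise_word qE -EFinM.
rewrite sumEFin lee_fin.
rewrite -(pair_big_dep xpredT (fun v (y : E * E) => (y.1 \in K v) && far y.1 y.2)
  (fun v (y : E * E) => q v * \prod_k bit_prob p (y.2 k)))/=.
rewrite -[leRHS]mul1r -[X in _ <= X * _]q1 mulr_suml; apply: ler_sum => v _.
rewrite -mulr_sumr ler_wpM2l//.
rewrite [leLHS](_ : _ = \sum_(c in K v) \sum_(e : E | far c e)
    \prod_k bit_prob p (e k)); last by rewrite pair_big_dep.
apply: (@le_trans _ _ (\sum_(c in K v) expR (- (t ^+ 2 / 4) * n%:R))).
  by apply: ler_sum => c _; exact: chernoff.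
rewrite sumr_const -[leLHS]mulr_natl ler_wpM2r ?expR_ge0// ler_nat; exact: KN.
Qed.

(** The only probabilistic facts about the noise that the convergence of
estimators depends on; the control is uniform over parameters and initial
points. *)
Definition noise_controlled (n : nat) (t : R) (w : Omega) : Prop :=
  n%:R^-1 * (\sum_(k < n) (eps k w)%:R) <= p + t /\
  forall th u, p + (1 - 2 * p) * mismatch F pi n (clean w) th u - t <=
    mismatch F pi n (obs F pi th0 X eps w) th u.

Lemma noise_controlled_le n (s t : R) w : s <= t ->
  noise_controlled n s w -> noise_controlled n t w.
Proof. by move=> st [h1 h2]; split=> [|th u]; [|have := h2 th u]; lra. Qed.

(** Countably many levels [t = j.+1%:R^-1] suffice. *)
Lemma noise_controlled_ae :
  (forall t : R, 0 < t <= 1 ->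
     \forall w \ae P, \forall n \near \oo, noise_controlled n t w) ->
  \forall w \ae P, forall t : R, 0 < t ->
     \forall n \near \oo, noise_controlled n t w.
Proof.
move=> H; have : \forall w \ae P, forall j : nat,
    \forall n \near \oo, noise_controlled n (j.+1%:R^-1) w.
  apply: ae_foralln => j; apply: H.
  by rewrite invr_gt0 ltr0n invf_le1 ?ltr0n// ler1n.
apply: filterS => w hw t t0; apply: filterS (hw (Num.truncn t^-1)) => n.
apply: noise_controlled_le.
rewrite -[leRHS]invrK lef_pV2 ?posrE ?invr_gt0//.
exact/ltW/truncnS_gt.
Qed.

Lemma noise_controlled0 : p = 0 ->
  \forall w \ae P, forall n t, 0 < t -> noise_controlled n t w.
Proof.
move=> p0; have : \forall w \ae P, forall k, eps k w = false.
  apply: ae_foralln => k.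
  have mk : measurable (eps k @^-1` [set true]).
    by rewrite -[X in measurable X]setTI; exact: measurable_funPT.
  have : P.-negligible (eps k @^-1` [set true]).
    have e0 : P (eps k @^-1` [set true]) = 0%E by rewrite noise_bit /= p0.
    exact/negligibleP.
  by apply: negligibleS => w /=; case: (eps k w).
apply: filterS => w hw n t t0; split=> [|th u].
  rewrite big1 ?mulr0 ?p0 ?add0r ?ltW// => k _.
  by rewrite hw.
rewrite (@eq_mismatch _ _ _ F pi n (obs F pi th0 X eps w) (clean w)).
  by rewrite p0; lra.
by move=> k _; rewrite /obs hw addbF.
Qed.

(** The differences between the labels [v] and all label words, for the lower
bound, and the constant word, for which a deviation from below of the distance
is one from above of the number of ones in the noise. *)
Let tested_words n (v : n.-tuple bool) : {set {ffun 'I_n -> bool}} :=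
  ([ffun=> true] |:
   [set [ffun k => tnth b k (+) tnth v k] | b in label_words F pi n])%SET.

Lemma noise_controlled_of_dev n (t : R) w : (0 < n)%N ->
  (forall c, c \in tested_words n (word n (clean w)) ->
     - (t * n%:R) <= \sum_k bit_dev p (c k) (noise n w k)) ->
  noise_controlled n t w.
Proof.
move=> n0 hc; have nR : 0 < (n%:R : R) by rewrite ltr0n.
split=> [|th u].
  have := hc [ffun=> true] (setU11 _ _).
  rewrite (eq_bigr (fun k : 'I_n => p - (eps k w)%:R)); last first.
    by move=> k _; rewrite /bit_dev !ffunE; case: (eps k w) => /=; lra.
  rewrite sumrB sumr_const card_ord -[p *+ n]mulr_natr ler_pdivrMl//.
  by rewrite mulrDr; lra.
have cK : [ffun k : 'I_n => tnth (word n (lab F pi th u)) k (+)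
    tnth (word n (clean w)) k] \in tested_words n (word n (clean w)).
  apply/setU1P; right; apply/imsetP; exists (word n (lab F pi th u)) => //.
  apply/label_wordP; exists (lab F pi th u) => //.
  by apply/label_closureP => m; exists th, u.
have := hc _ cK.
rewrite (eq_bigr (fun k : 'I_n =>
    (lab F pi th u k != obs F pi th0 X eps w k)%:R - p -
    (1 - 2 * p) * (lab F pi th u k != clean w k)%:R)); last first.
  move=> k _; rewrite /bit_dev !ffunE !tnth_mktuple /obs -/(clean w k).
  by case: (lab F pi th u k); case: (clean w k); case: (eps k w) => /=.
rewrite !sumrB sumr_const card_ord -[p *+ n]mulr_natr -mulr_sumr.
rewrite /mismatch; set S := \sum_(i < n) _; set S' := \sum_(i < n) _.
move=> h; rewrite -(ler_pM2l nR).
have nV (x : R) : n%:R * (n%:R^-1 * x) = x by rewrite mulrA divff ?mul1r// gt_eqF.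
by rewrite nV mulrBr mulrDr (mulrCA n%:R (1 - 2 * p)) nV; lra.
Qed.

(** The number of label words is eventually at most [expR (s * n%:R)], half of
the decay rate [t ^+ 2 / 4 = s + s] of the Chernoff bound; the other half makes
the union bounds summable. *)
Lemma noise_controlled_entropy0 (t : R) : entropy F pi = 0 -> 0 < t <= 1 ->
  \forall w \ae P, \forall n \near \oo, noise_controlled n t w.
Proof.
move=> h0 /andP[t0 t1].
(* Half of the Chernoff rate, to be spent on counting label words. *)
pose s := t ^+ 2 / 8.
have s0 : 0 < s by rewrite divr_gt0// exprn_gt0.
have Kcard n v : (#|tested_words n v| <= 1 + #|label_words F pi n|)%N.
  rewrite cardsU1 leq_add ?leq_b1//; exact: leq_imset_card.
have t01 : 0 <= t <= 1 by rewrite ltW.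
pose Bad n := [set w | exists2 c, c \in tested_words n (word n (clean w)) &
    \sum_k bit_dev p (c k) (noise n w k) < - (t * n%:R)].
have badP n := chernoff_event n t _ (tested_words n) (Kcard n) t01.
have r01 : 0 < expR (- s) < 1 by rewrite expR_gt0 expR_lt1; lra.
have : \forall w \ae P, \forall n \near \oo, ~ Bad n w.
  apply: (borel_cantelli P Bad 2 _ (fun n => (badP n).1) _ r01) => //.
  apply: filterS (card_label_words_entropy0 F pi s h0 s0) => n hn.
  apply: le_trans (badP n).2 _; rewrite lee_fin -expRM_natr.
  have -> : - (t ^+ 2 / 4) * n%:R = - s * n%:R + - s * n%:R.
    by rewrite /s; field.
  rewrite expRD mulrA ler_wpM2r ?expR_ge0// natrD.
  have e1 : 1 <= expR (s * n%:R) by rewrite -[leLHS]expR0 ler_expR mulr_ge0// ltW.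
  rewrite mulNr expRN ler_pdivrMr ?expR_gt0//; lra.
apply: filterS => w; apply: filterS2 (nbhs_infty_gt 0) => n n0 nb.
apply: noise_controlled_of_dev => // c cK.
by rewrite leNgt; apply/negP => h; apply: nb; exists c.
Qed.

(** * Empirical risk minimisers *)

Hypothesis hcase : p = 0 \/ (0 < p < 2^-1 /\ entropy F pi = 0).

Lemma noise_control : \forall w \ae P, forall t : R, 0 < t ->
  \forall n \near \oo, noise_controlled n t w.
Proof.
case: hcase => [p0|[_ h0]].
  by apply: filterS (noise_controlled0 p0) => w h t t0; apply: nearW => n; exact: h.
by apply: noise_controlled_ae => t t01; exact: noise_controlled_entropy0.
Qed.

(** Where the labels are reproduced exactly, the only errors left are those of
the noise. *)
Lemma mismatch_obs_agree n th u w : agree n (clean w) (lab F pi th u) ->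
  mismatch F pi n (obs F pi th0 X eps w) th u =
  n%:R^-1 * \sum_(k < n) (eps k w)%:R.
Proof.
move=> h; rewrite /mismatch; congr (_ * _); apply: eq_bigr => k _.
rewrite /obs -/(lab F pi th u k) h// -/(clean w k).
by case: (clean w k); case: (eps k w).
Qed.

Lemma global_min_mismatch_cvg w :
  (forall t : R, 0 < t -> \forall n \near \oo, noise_controlled n t w) ->
  global_min_mismatch F pi n (obs F pi th0 X eps w) @[n --> \oo] --> p.
Proof.
move=> ctl; apply/cvgrPdist_le => t t0; apply: filterS (ctl t t0) => n [up lo].
have p2 : 0 <= 1 - 2 * p by case: hcase => [->|[/andP[_ ?] _]]; lra.
have glo : p - t <= global_min_mismatch F pi n (obs F pi th0 X eps w).
  apply: global_min_mismatch_ge => th u; apply: le_trans (lo th u).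
  have m0 := mismatch_ge0 F pi n (clean w) th u.
  by have := mulr_ge0 p2 m0; lra.
have gup : global_min_mismatch F pi n (obs F pi th0 X eps w) <= p + t.
  apply: le_trans up; rewrite -(mismatch_obs_agree n th0 (X w) w)//.
  exact: le_trans (global_min_mismatch_le _ _ _ _ th0) (min_mismatch_le _ _ _ _ _ _).
by rewrite ler_distl; lra.
Qed.

(** As [1 - 2 * p] is positive, a mismatch with the observations close to its
floor [p] leaves no room for a mismatch with the noise-free labels. *)
Lemma min_mismatch_label_cvg w (th : nat -> Theta) :
  (forall t : R, 0 < t -> \forall n \near \oo, noise_controlled n t w) ->
  min_mismatch F pi n (obs F pi th0 X eps w) (th n) @[n --> \oo] --> p ->
  min_mismatch F pi n (clean w) (th n) @[n --> \oo] --> (0 : R).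
Proof.
move=> ctl mp; apply/cvgrPdist_le => e e0.
have p2 : 0 < 1 - 2 * p by case: hcase => [->|[/andP[_ ?] _]]; lra.
have t0 : 0 < (1 - 2 * p) * (e / 2) by rewrite mulr_gt0 ?divr_gt0.
move/cvgrPdist_le/(_ _ t0) : mp; apply: filterS2 (ctl _ t0) => n [_ lo] mp.
rewrite sub0r normrN ger0_norm ?min_mismatch_ge0//.
rewrite -(ler_pM2l p2).
have : p + (1 - 2 * p) * min_mismatch F pi n (clean w) (th n) -
    (1 - 2 * p) * (e / 2) <=
    min_mismatch F pi n (obs F pi th0 X eps w) (th n).
  apply: min_mismatch_ge => u; apply: le_trans (lo (th n) u).
  have := min_mismatch_le F pi n (clean w) (th n) u.
  by rewrite -(ler_pM2l p2); lra.
by move: mp; rewrite ler_distlC => /andP[_]; lra.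
Qed.

Lemma estimates_approach_Theta1 (theta : forall n, n.-tuple bool -> Theta) :
  compact [set: Theta] ->
  {ae P, forall w, min_error F pi theta (obs F pi th0 X eps w)} ->
  {ae P, forall w,
     (fun n => edist_inf (Theta1 F pi P th0 X)
                 (estimate theta n (obs F pi th0 X eps w))) @ \oo --> 0%E}.
Proof.
move=> cT; apply: filterS3 (label_consistency cT) noise_control.
move=> w cons ctl [l [mm gm]]; apply: cons; apply: min_mismatch_label_cvg => //.
have <- // : l = p.
exact: (cvg_unique _ gm (global_min_mismatch_cvg w ctl)).
Qed.

(** The estimator minimises the mismatch over a shrinking ball around [t]; the
slack [r n] makes a minimiser exist without discussing whether the infimum is
attained. *)
Lemma estimators_converging_to t : Theta1 F pi P th0 X t ->
  exists theta : forall n, n.-tuple bool -> Theta,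
    [/\ measurable_estimators theta,
        {ae P, forall w, min_error F pi theta (obs F pi th0 X eps w)} &
        {ae P, forall w,
           (fun n => estimate theta n (obs F pi th0 X eps w)) @ \oo --> t}].
Proof.
move=> /label_slice_ae tslice.
pose r n : R := n.+1%:R^-1.
have r0 n : 0 < r n by rewrite invr_gt0.
have /choice[theta' htheta'] : forall x : {n & n.-tuple bool}, exists th,
    ball t (r (projT1 x)) th /\ forall th', ball t (r (projT1 x)) th' ->
      min_mismatch F pi (projT1 x) (nth false (projT2 x)) th <=
      min_mismatch F pi (projT1 x) (nth false (projT2 x)) th' + r (projT1 x).
  move=> [n v] /=.
  pose S := [set min_mismatch F pi n (nth false v) th | th in ball t (r n)].
  have Sinf : has_inf S.
    split; first by exists (min_mismatch F pi n (nth false v) t), t => //; exact: ballxx.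
    by exists 0 => _ [th _ <-]; exact: min_mismatch_ge0.
  have [_ [th bth <-] hth] := inf_adherent (r0 n) Sinf.
  exists th; split => // th' bth'; apply: le_trans (ltW hth) _.
  by rewrite lerD2r; apply: ge_inf; [exact: Sinf.2|exists th'].
pose theta n (v : n.-tuple bool) := theta' (existT _ n v).
have thetaP n y : ball t (r n) (estimate theta n y) /\
    forall th', ball t (r n) th' ->
      min_mismatch F pi n y (estimate theta n y) <= min_mismatch F pi n y th' + r n.
  have [h1 h2] := htheta' (existT _ n (word n y)); split => // th' /h2 /=.
  rewrite !(@eq_min_mismatch _ _ _ F pi n (nth false (word n y)) y)//;
    by move=> k; exact: nth_word.
have rcvg (e : R) : 0 < e -> \forall n \near \oo, r n < e.
  move=> e0; have /cvgrPdist_lt/(_ e e0) := @cvg_harmonic R.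
  by apply: filterS => n; rewrite sub0r normrN ger0_norm// ltW.
exists theta; split.
- move=> n _ B _; rewrite setTI.
  rewrite (_ : _ @^-1` B = (fun v : n.-tuple bool => v) @^-1` (theta n @^-1` B))//.
  apply: measurable_preimage_fin => v.
  rewrite (_ : _ @^-1` _ = \bigcap_(i in [set: 'I_n])
      ((fun v' : n.-tuple bool => tnth v' i) @^-1` [set tnth v i])).
    apply: fin_bigcap_measurable => // i _.
    by rewrite -[X in measurable X]setTI; exact: measurable_tnth.
  apply/seteqP; split=> v' /=; first by move=> <-.
  by move=> h; apply: eq_from_tnth => i; exact: h.
- apply: filterS2 tslice noise_control => w sl ctl.
  exists p; split; last exact: global_min_mismatch_cvg.
  apply/cvgrPdist_le => e e0.
  have e20 : 0 < e / 2 by rewrite divr_gt0.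
  near=> n.
  have [up lo] : noise_controlled n (e / 2) w by near: n; exact: ctl.
  have [b1 b2] := thetaP n (obs F pi th0 X eps w).
  have [th' [u [bth' ag]]] := (label_graphP F pi t (clean w)).1 sl n (r n) (r0 n).
  have h1 := b2 th' bth'.
  have h2 := min_mismatch_le F pi n (obs F pi th0 X eps w) th' u.
  rewrite (mismatch_obs_agree n th' u w ag) in h2.
  have h3 : r n < e / 2 by near: n; exact: rcvg.
  have h4 : p - e / 2 <= min_mismatch F pi n (obs F pi th0 X eps w)
      (estimate theta n (obs F pi th0 X eps w)).
    apply: min_mismatch_ge => v; apply: le_trans (lo _ v).
    have p2 : 0 <= 1 - 2 * p by case: hcase => [->|[/andP[_ ?] _]]; lra.
    have m0 := mismatch_ge0 F pi n (clean w) (estimate theta n (obs F pi th0 X eps w)) v.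
    by have := mulr_ge0 p2 m0; lra.
  by rewrite ler_distlC; lra.
- apply: aeW => w; apply/cvg_ballP => e e0; apply: filterS (rcvg e e0) => n rn.
  by apply: le_ball (ltW rn) _ _; exact: (thetaP n _).1.
Unshelve. all: by end_near. Qed.
End model.

Theorem theorem5p1 (R : realType)
  (U : ptopologicalType) (hU : polish_space R U)
  (Theta : pmetricType R) (hTheta : compact [set: Theta])
  (F : Theta -> U -> U)
  (hF : forall th, borel_measurable (F th))
  (hFjoint : borel_measurable (fun x : Theta * U => F x.1 x.2))
  (A : bool -> set U) (hA : measurable_partition A)
  (pi : U -> bool) (hpi : forall j u, A j u -> pi u = j)
  (th0 : Theta)
  (d : measure_display) (Omega : measurableType d) (P : probability Omega R)
  (X : {RV P >-> borel U})
  (hinv : invariant_law (distribution P X) (F th0))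
  (herg : ergodic_law (distribution P X) (F th0))
  (p : R) (eps : nat -> {RV P >-> bool})
  (hbern : forall k, distribution P (eps k) =1 bernoulli_prob p)
  (hind : independent_family P (fun k => eps k : Omega -> bool))
  (hindX : independent P X
             (fun w => (fun k => eps k w) : borel cantor_space))
  (hcase : p = 0 \/ (0 < p < 2^-1 /\ entropy F pi = 0)) :
  (forall theta : forall n, n.-tuple bool -> Theta,
     measurable_estimators theta ->
     {ae P, forall w, min_error F pi theta (obs F pi th0 X eps w)} ->
     {ae P, forall w,
        (fun n => edist_inf (Theta1 F pi P th0 X)
                    (estimate theta n (obs F pi th0 X eps w)))
          @ \oo --> 0%E}) /\
  (forall th_star, Theta1 F pi P th0 X th_star ->
     exists theta : forall n, n.-tuple bool -> Theta,
       [/\ measurable_estimators theta,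
           {ae P, forall w, min_error F pi theta (obs F pi th0 X eps w)} &
           {ae P, forall w,
              (fun n => estimate theta n (obs F pi th0 X eps w))
                @ \oo --> th_star}]).
Proof.
have mpi b : measurable ([set u | pi u = b] : set (borel U)).
  have [mA _ cover] := hA; rewrite (_ : [set u | pi u = b] = A b)//.
  apply/seteqP; split=> u /=; last exact: hpi.
  have [j _ Aj] : (\bigcup_j A j) u by rewrite cover.
  by rewrite (hpi _ _ Aj) => <-.
have p01 : 0 <= p <= 1.
  by case: hcase => [->|[/andP[p0 p1] _]]; rewrite ?lexx ?ler01//; lra.
split=> [theta _|t].
- exact: (estimates_approach_Theta1 F pi th0 P X (hF th0) mpi hinv herg p eps hbern
    hind hindX p01 hcase theta hTheta).
- exact: (estimators_converging_to F pi th0 P X (hF th0) mpi p eps hbern hind hindX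
    p01 hcase t).
Qed.
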